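(* Let $N\ge 2$ be a prime, let $\{b_k\}_{k=1}^\infty$ be a sequence of integers with $|b_k|\ge 2$, let $\{t_k\}_{k=1}^\infty$ be a bounded sequence of integers with $|t_k|\ge 1$, and let $D_k=\{0,1,\dots,N-1\}\,t_k$ for $k\ge1$. Let $\mathbf{s}_k=\tau_N(b_1b_2\cdots b_k)-\tau_N(Nt_k)$ for $k\ge 1$. Then $$D_k\oplus b_kD_{k-1}\oplus b_kb_{k-1}D_{k-2}\oplus\cdots\oplus b_kb_{k-1}\cdots b_2D_1$$ is an integer tile for each $k\in\mathbb{N}^+$ (in particular, these sums are direct) if and only if $\mathbf{s}_i\ne\mathbf{s}_j$ for all $i\ne j\in\mathbb{N}^+$.
   Context: $\mathbb{N}^+=\{1,2,3,\dots\}$. For a nonzero integer $A$, $\tau_N(A)=\max\{k\in\{0,1,2,\dots\}:N^k\mid A\}$. $\{0,1,\dots,N-1\}t=\{0,t,2t,\dots,(N-1)t\}$ and $cE=\{ce:e\in E\}$. The notation $A_1\oplus\cdots\oplus A_m$ denotes the sumset $A_1+\cdots+A_m$ together with the assertion that the sum is direct, i.e. every element has a unique representation $a_1+\cdots+a_m$ with $a_i\in A_i$. A finite set $D\subset\mathbb{Z}$ is an integer tile if there exist an integer $p\ge 1$ and a set $L\subset\mathbb{Z}$ such that $D\oplus L=\mathbb{Z}_p:=\mathbb{Z}/p\mathbb{Z}$, i.e. the sums $d+l$ ($d\in D$, $l\in L$) represent each residue class modulo $p$ exactly once. For $k=1$ the set in the claim is $D_1$. *)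

(* Defs.v *)
From HB Require Import structures.
From mathcomp Require Import all_boot all_order all_algebra.
From mathcomp Require Import all_classical.
Set Implicit Arguments.
Unset Strict Implicit.
Unset Printing Implicit Defensive.
Import Order.TTheory GRing.Theory Num.Theory.
Local Open Scope classical_set_scope.
Local Open Scope ring_scope.

(* The largest k with N ^ k | A.  The range of k loses nothing when 1 < N and
   A != 0, since then N ^ k | A forces k < N ^ k <= |A|; see dvdz_exp_tau. *)
Definition tau (N : nat) (A : int) : nat :=
  (\max_(k < `|A|%N.+1 | (N%:Z ^+ k %| A)%Z) k)%N.

Lemma dvdz_exp_tau (N : nat) (A : int) (k : nat) :
  (1 < N)%N -> A != 0 -> (N%:Z ^+ k %| A)%Z = (k <= tau N A)%N.
Proof.
move=> N1 A0; have A1 : (0 < `|A|)%N by rewrite absz_gt0.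
have dvdE m : (N%:Z ^+ m %| A)%Z = (N ^ m %| `|A|)%N.
  by rewrite /dvdz abszX absz_nat.
apply/idP/idP => [kA|kt].
  have kb : (k < `|A|.+1)%N.
    rewrite ltnS; apply: leq_trans (ltnW (ltn_expl k N1)) _.
    by apply: dvdn_leq => //; rewrite -dvdE.
  exact: (@leq_bigmax_cond _ _ (fun i : 'I_`|A|.+1 => i : nat) (Ordinal kb)).
rewrite dvdE; apply: (dvdn_trans (dvdn_exp2l N kt)); rewrite -dvdE.
rewrite /tau; elim/big_ind : _ => [|m n|i //]; first by rewrite expr0 dvd1z.
by rewrite /maxn; case: ifP.
Qed.

Definition dilate (c : int) (E : set int) : set int := [set c * e | e in E].

Definition digits (N : nat) (t : int) : set int :=
  [set j%:Z * t | j in [set j : nat | (j < N)%N]].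

Definition sumset (m : nat) (A : 'I_m -> set int) : set int :=
  [set x | exists2 a : 'I_m -> int, (forall i, A i (a i)) & x = \sum_i a i].

Definition direct (m : nat) (A : 'I_m -> set int) : Prop :=
  forall a a' : 'I_m -> int, (forall i, A i (a i)) -> (forall i, A i (a' i)) ->
    \sum_i a i = \sum_i a' i -> forall i, a i = a' i.

Definition integer_tile (D : set int) : Prop :=
  finite_set D /\
  exists (p : nat) (L : set int), (0 < p)%N /\
    forall z : int, exists! dl : int * int,
      [/\ D dl.1, L dl.2 & (dl.1 + dl.2 = z %[mod p])%Z].

(* Sequences indexed by {1, 2, ...} are functions on nat whose value at 0 is
   never used. *)
Definition s_ (N : nat) (b t : nat -> int) (k : nat) : int :=
  (tau N (\prod_(1 <= i < k.+1) b i))%:Z - (tau N (N%:Z * t k))%:Z.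

(* The k summands D_k, b_k D_(k-1), ..., b_k ... b_2 D_1: the i-th one,
   counted from 0, is b_k b_(k-1) ... b_(k-i+1) D_(k-i). *)
Definition summand (N : nat) (b t : nat -> int) (k : nat) (i : 'I_k) :
    set int :=
  dilate (\prod_((k - i).+1 <= l < k.+1) b l) (digits N (t (k - i)%N)).

(* Main.v *)
Require Import Defs.
From HB Require Import structures.
From mathcomp Require Import all_boot all_order all_algebra.
From mathcomp Require Import all_field ring.
From mathcomp Require Import all_classical.
Set Implicit Arguments.
Unset Strict Implicit.
Unset Printing Implicit Defensive.
Import Order.TTheory GRing.Theory Num.Theory.
Local Open Scope classical_set_scope.
Local Open Scope ring_scope.

(* The k-th sumset consists of the digit sums with the k weights
   b_k ... b_(m+1) t_m, m <= k, and s_m is, up to a constant depending on k and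
   a sign, the N-adic valuation of the m-th weight.  So it is to be shown that
   the digit sums are direct and tile if and only if the valuations of the
   weights are distinct.  If they are, powers of N supply the missing
   valuations below a bound K, and the digits of the enlarged family represent
   each residue modulo N^K once, the digits being recovered in the order of the
   valuations.  Conversely, let L be a complement modulo p.  At a primitive root
   of unity of order N^a dividing p, the product of the mask polynomials of the
   digit sums and of L vanishes, while the first factor vanishes only if a - 1
   is one of the valuations.  So L(X) is divisible by all the other cyclotomic
   polynomials of order N^a, each of which takes the value N at 1, and counting
   the factors N in p = N^k #L shows that there are k valuations. *)

(** * Residues and valuations *)

Lemma PoszX (N e : nat) : (N ^ e)%N%:Z = N%:Z ^+ e.
Proof. by rewrite -!natz natrX. Qed.

Lemma absz_modz (p : nat) (m : int) :
  (0 < p)%N -> `|(m %% p)%Z|%N%:Z = (m %% p)%Z.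
Proof. by move=> p0; rewrite gez0_abs // modz_ge0 // -lt0n. Qed.

Lemma ltn_absz_modz (p : nat) (m : int) : (0 < p)%N -> (`|(m %% p)%Z| < p)%N.
Proof. by move=> p0; rewrite -ltz_nat absz_modz // ltz_pmod. Qed.

Definition digit_sum (N : nat) (I : finType) (W : I -> int)
    (x : {ffun I -> 'I_N}) : int :=
  \sum_i (x i)%:Z * W i.

Lemma tauE (N : nat) (A : int) :
  prime N -> A != 0 -> tau N A = logn N `|A|.
Proof.
move=> N_prime A0.
have E k : (k <= tau N A)%N = (k <= logn N `|A|)%N.
  rewrite -dvdz_exp_tau ?prime_gt1 // -pfactor_dvdn ?absz_gt0 //.
  by rewrite dvdzE abszX absz_nat.
by apply/eqP; rewrite eqn_leq -E leqnn E leqnn.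
Qed.

Lemma tauM (N : nat) (A B : int) :
  prime N -> A != 0 -> B != 0 -> tau N (A * B) = (tau N A + tau N B)%N.
Proof.
by move=> Np A0 B0; rewrite !tauE ?mulf_neq0 // abszM lognM ?absz_gt0.
Qed.

(** * Digit sums modulo powers of [N] *)

(** Among the indices with a nonzero coefficient, take the one whose weight has the least valuation
    [v]. All other terms are divisible by [N ^ v.+1], hence so is this one; but its coefficient is
    prime to [N], being nonzero and smaller than [N] in absolute value. *)
Lemma dvdz_exp_sum_eq0 (N K : nat) (I : finType) (W c : I -> int) :
    prime N -> (forall i, W i != 0) -> injective (fun i => tau N (W i)) ->
    (forall i, (tau N (W i) < K)%N) -> (forall i, `|c i| < N%:Z) ->
    (N%:Z ^+ K %| \sum_i c i * W i)%Z ->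
  forall i, c i = 0.
Proof.
move=> Np W0 Winj WK cN dvdS i0; apply/eqP/negPn/negP => ci0.
case: (arg_minnP (P := fun i => c i != 0) (fun i => tau N (W i)) ci0).
move=> i ci min_i.
have NdvdS : (N%:Z ^+ (tau N (W i)).+1 %| \sum_i c i * W i)%Z.
  by apply: dvdz_trans dvdS; rewrite dvdz_exp2l.
have Nrest : (N%:Z ^+ (tau N (W i)).+1 %| \sum_(j | j != i) c j * W j)%Z.
  apply: rpred_sum => j ji; have [->|cj] := eqVneq (c j) 0.
    by rewrite mul0r dvdz0.
  apply: dvdz_mull; rewrite dvdz_exp_tau ?prime_gt1 //.
  rewrite ltn_neqAle min_i // andbT.
  by apply: contra ji => /eqP/Winj ->.
move: NdvdS; rewrite (bigD1 i) //= rpredDr // Gauss_dvdzr.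
  by rewrite dvdz_exp_tau ?prime_gt1 // ltnn.
rewrite coprimezE abszX absz_nat coprimeXl // prime_coprime //.
apply/negP => /dvdn_leq; rewrite absz_gt0 => /(_ ci).
by rewrite leqNgt -ltz_nat abszE cN.
Qed.

Lemma digit_sum_inj_mod (N K : nat) (I : finType) (W : I -> int)
    (x y : {ffun I -> 'I_N}) :
    prime N -> (forall i, W i != 0) -> injective (fun i => tau N (W i)) ->
    (forall i, (tau N (W i) < K)%N) ->
    (N%:Z ^+ K %| digit_sum W x - digit_sum W y)%Z ->
  x = y.
Proof.
move=> Np W0 Winj WK dvdB; apply/ffunP => i; apply/val_inj/eqP.
rewrite -eqz_nat -subr_eq0; apply/eqP; move: i.
apply: (dvdz_exp_sum_eq0 Np W0 Winj WK) => [i|].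
  have := ltn_ord (x i); have := ltn_ord (y i).
  rewrite -!ltz_nat => lty ltx.
  rewrite ltr_norml ltrBrDl !ltrBlDl; apply/andP; split.
    by apply: (lt_le_trans lty); rewrite lerDl.
  by apply: (lt_le_trans ltx); rewrite lerDr.
by under eq_bigr do rewrite mulrBl; rewrite sumrB.
Qed.

(** There are as many digit vectors as residues modulo [N ^ #|I|], so injectivity gives
    surjectivity. *)
Lemma digit_sum_surj_mod (N : nat) (I : finType) (W : I -> int) (z : int) :
    prime N -> (forall i, W i != 0) -> injective (fun i => tau N (W i)) ->
    (forall i, (tau N (W i) < #|I|)%N) ->
  exists x : {ffun I -> 'I_N}, (N%:Z ^+ #|I| %| digit_sum W x - z)%Z.
Proof.
move=> Np W0 Winj WK; set p := (N ^ #|I|)%N.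
have p0 : (0 < p)%N by rewrite expn_gt0 prime_gt0.
pose f (x : {ffun I -> 'I_N}) : 'I_p :=
  Ordinal (ltn_absz_modz (digit_sum W x) p0).
have f_inj : injective f.
  move=> x y /(congr1 (fun i => (val i)%:Z)); rewrite /= !absz_modz // => /eqP.
  by rewrite eqz_mod_dvd PoszX; apply: digit_sum_inj_mod.
have [|g _ fK] := inj_card_bij f_inj; first by rewrite card_ffun !card_ord.
pose r : 'I_p := Ordinal (ltn_absz_modz z p0).
exists (g r); rewrite -PoszX -eqz_mod_dvd.
have /(congr1 (fun i => (val i)%:Z)) := fK r.
by rewrite /= !absz_modz // => ->.
Qed.

(** * Sumsets of digit sets as digit sums *)

Lemma digits_choice (N : nat) (I : finType) (w a : I -> int) :
  (forall i, digits N (w i) (a i)) ->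
  exists x : {ffun I -> 'I_N}, a =1 fun i => (x i)%:Z * w i.
Proof.
move=> aP; have /choice[x xP] : forall i, exists j : 'I_N, a i = j%:Z * w i.
  by move=> i; have [j jN <-] := aP i; exists (Ordinal jN).
by exists [ffun i => x i] => i; rewrite ffunE.
Qed.

Lemma mem_digits (N : nat) (j : 'I_N) (w : int) : digits N w (j%:Z * w).
Proof. by exists j => //=; exact: ltn_ord. Qed.

Lemma sumset_digitsP (N k : nat) (w : 'I_k -> int) (d : int) :
  sumset (fun i => digits N (w i)) d <->
  exists x : {ffun 'I_k -> 'I_N}, d = digit_sum w x.
Proof.
split=> [[a /digits_choice[x xE] ->]|[x ->]].
  by exists x; apply: eq_bigr => i _; rewrite xE.
by exists (fun i => (x i)%:Z * w i) => // i; apply: mem_digits.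
Qed.

Lemma direct_digitsP (N k : nat) (w : 'I_k -> int) : (forall i, w i != 0) ->
  direct (fun i => digits N (w i)) <-> injective (@digit_sum N _ w).
Proof.
move=> w0; split=> [dir x y xy|inj a a'].
  apply/ffunP => i; apply/val_inj/eqP; rewrite -eqz_nat; apply/eqP.
  apply: (mulIf (w0 i)); move: i.
  by apply: dir => // i; apply: mem_digits.
move=> /digits_choice[x xE] /digits_choice[y yE] aa' i.
rewrite xE yE; congr ((_ _)%:Z * _); congr (fun_of_fin _ _); apply: inj.
by rewrite /digit_sum -(eq_bigr _ (fun j _ => xE j)) aa'; apply: eq_bigr.
Qed.

(** * From distinct valuations to tilings *)

Lemma tile_of_inj_tau (N k : nat) (w : 'I_k -> int) :
    prime N -> (forall i, w i != 0) -> injective (fun i => tau N (w i)) ->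
  direct (fun i => digits N (w i)) /\
  integer_tile (sumset (fun i => digits N (w i))).
Proof.
move=> Np w0 winj.
pose K := (\max_i tau N (w i)).+1.
have ltK i : (tau N (w i) < K)%N by rewrite ltnS (leq_bigmax_cond i).
pose v i := Ordinal (ltK i).
have v_inj : injective v by move=> i j /(congr1 val) /winj.
(* The valuations missing from [w] are supplied by powers of [N]. *)
pose J := {j : 'I_K | j \notin codom v}.
pose W (i : 'I_k + J) : int :=
  match i with inl i => w i | inr j => N%:Z ^+ val j end.
have tauX m : tau N (N%:Z ^+ m) = m.
  rewrite tauE // ?expf_neq0 ?abszX ?absz_nat ?pfactorK //.
  by rewrite eqz_nat -lt0n prime_gt0.
have N0 m : N%:Z ^+ m != 0 by rewrite expf_neq0 // eqz_nat -lt0n prime_gt0.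
have W0 i : W i != 0 by case: i => [i|j] /=.
have Winj : injective (fun i => tau N (W i)).
  have ne i (j : J) : tau N (w i) <> tau N (N%:Z ^+ val j).
    rewrite tauX => ij; have /negP[] := valP j.
    by rewrite (_ : val j = v i) ?codom_f //; apply: val_inj.
  case=> [i|i] [j|j] /=.
  - by move=> /winj ->.
  - by move=> /ne.
  - by move=> /esym/ne.
  - by rewrite !tauX => /val_inj/val_inj ->.
(* The valuations of [W] are exactly the numbers below [K], each taken once, so the number of digit
   vectors equals the modulus [N ^ K]. *)
have cardI : #|{: 'I_k + J}| = K.
  rewrite card_sum card_ord card_sig -[RHS](card_ord K).
  rewrite -(cardC (mem (codom v))).
  by rewrite card_codom ?card_ord.
have WK i : (tau N (W i) < K)%N by case: i => [i|j] //=; rewrite tauX.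
have splitE (x : {ffun 'I_k + J -> 'I_N}) : digit_sum W x =
    digit_sum w [ffun i => x (inl i)] +
    digit_sum (fun j : J => N%:Z ^+ val j) [ffun j => x (inr j)].
  by rewrite /digit_sum big_sumType /=; congr (_ + _); apply: eq_bigr => i _;
    rewrite ffunE.
have joinE (x : {ffun 'I_k -> 'I_N}) (y : {ffun J -> 'I_N}) :
    digit_sum w x + digit_sum (fun j : J => N%:Z ^+ val j) y =
    digit_sum W [ffun i => match i with inl i => x i | inr j => y j end].
  by rewrite splitE; congr (_ + _); congr digit_sum; apply/ffunP => i;
    rewrite !ffunE.
split.
  apply/direct_digitsP => // x y xy.
  by apply: (digit_sum_inj_mod Np w0 winj ltK); rewrite xy subrr dvdz0.
split.
  apply: (@sub_finite_set _ _ (range (@digit_sum N _ w))); last first.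
    by apply: finite_image; exact: finite_finset.
  by move=> d /sumset_digitsP[x ->]; exists x.
exists (N ^ K)%N,
  (range (@digit_sum N _ (fun j : J => N%:Z ^+ val j))).
split=> [|z]; first by rewrite expn_gt0 prime_gt0.
have [|x] := @digit_sum_surj_mod N _ W z Np W0 Winj; first by rewrite cardI.
rewrite cardI -PoszX -eqz_mod_dvd splitE => /eqP xz.
set x1 := [ffun i => _] in xz; set x2 := [ffun i => _] in xz.
exists (digit_sum w x1, digit_sum (fun j : J => N%:Z ^+ val j) x2).
split=> [|[d l] /= []].
  by split=> //=; [apply/sumset_digitsP; exists x1 | exists x2].
move=> /sumset_digitsP[y1 ->] [y2 _ <-] yz.
have : (N%:Z ^+ K %| digit_sum W x - digit_sum W
    [ffun i => match i with inl i => y1 i | inr j => y2 j end])%Z.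
  by rewrite -PoszX -eqz_mod_dvd -joinE splitE yz xz.
move=> /(digit_sum_inj_mod Np W0 Winj WK) xy.
have -> : x1 = y1 by apply/ffunP => i; rewrite ffunE xy ffunE.
have -> // : x2 = y2 by apply/ffunP => i; rewrite ffunE xy ffunE.
Qed.

(** * Cyclotomic factors of prime power order *)

(* For [N] prime this is the cyclotomic polynomial of order [N ^ a.+1]. *)
Definition cyclo (N a : nat) : {poly int} := \sum_(j < N) 'X^(N ^ a * j).

Lemma cycloE (N a : nat) :
  ('X^(N ^ a) - 1) * cyclo N a = 'X^(N ^ a.+1) - 1.
Proof.
rewrite expnSr exprM [RHS]subrX1; congr (_ * _).
by apply: eq_bigr => j _; rewrite exprM.
Qed.

Lemma cyclo_monic (N a : nat) : (0 < N)%N -> cyclo N a \is monic.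
Proof.
move=> N0; rewrite -(@monicMl _ ('X^(N ^ a) - 1)) ?cycloE;
  by apply: monicXnsubC; rewrite expn_gt0 N0.
Qed.

Lemma prod_cyclo (N m : nat) :
  ('X - 1) * \prod_(a < m) cyclo N a = 'X^(N ^ m) - 1.
Proof.
elim: m => [|m IHm]; first by rewrite big_ord0 mulr1 expn0 expr1.
by rewrite big_ord_recr /= mulrA IHm cycloE.
Qed.

Lemma horner_cyclo (R : comNzRingType) (N a : nat) (x : R) :
  (map_poly intr (cyclo N a)).[x] = \sum_(j < N) (x ^+ (N ^ a)) ^+ j.
Proof.
rewrite rmorph_sum horner_sum; apply: eq_bigr => j _ /=.
by rewrite map_polyXn hornerXn exprM.
Qed.

Lemma root_cyclo (N a : nat) (x : algC) : (0 < N)%N ->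
  root (map_poly intr (cyclo N a)) x ->
  x ^+ (N ^ a) != 1 /\ x ^+ (N ^ a.+1) = 1.
Proof.
move=> N0 /rootP; rewrite horner_cyclo => x0; split.
  apply/eqP => x1; move/eqP: x0; rewrite x1.
  under eq_bigr do rewrite expr1n.
  by rewrite sumr_const card_ord pnatr_eq0 -leqn0 leqNgt N0.
by apply/eqP; rewrite -subr_eq0 expnSr exprM subrX1 x0 mulr0.
Qed.

Lemma cyclo1 (N a : nat) : (cyclo N a).[1] = N%:R.
Proof.
rewrite horner_sum; under eq_bigr do rewrite hornerXn expr1n.
by rewrite sumr_const card_ord.
Qed.

(** The product [M] of the factors [cyclo N a] with [a] in [A] divides ['X^(N ^ m) - 1], so its
    roots are simple. They are roots of [P], so [M] divides [P], and at 1 the product [M] takes the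
    value [N ^ #|A|]. *)
Lemma dvdz_horner1 (N m : nat) (A : {set 'I_m}) (P : {poly int}) :
    (0 < N)%N ->
    (forall (a : 'I_m) (x : algC), a \in A -> x ^+ (N ^ a) != 1 ->
       x ^+ (N ^ a.+1) = 1 -> root (map_poly intr P) x) ->
  (N%:Z ^+ #|A| %| P.[1])%Z.
Proof.
move=> N0 rootP; set M := \prod_(a in A) cyclo N a.
have M_monic : M \is monic.
  by apply: monic_prod => a _; apply: cyclo_monic.
have Mdvd : map_poly intr M %| ('X^(N ^ m) - 1 : {poly algC}).
  have -> : 'X^(N ^ m) - 1 = map_poly intr ('X^(N ^ m) - 1) :> {poly algC}.
    by rewrite rmorphB rmorph1 /= map_polyXn.
  rewrite -prod_cyclo (bigID (mem A)) /= -/M mulrCA rmorphM /=.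
  exact: dvdp_mulr.
suff : map_poly intr M %| (map_poly intr P : {poly algC}).
  (* Divisibility descends from [algC] to the rationals and then to the integers, where the quotient
     exists because [M] is monic. *)
  have intrE (q : {poly int}) : map_poly intr q =
      map_poly ratr (map_poly intr q : {poly rat}) :> {poly algC}.
    by rewrite -map_poly_comp; apply: eq_map_poly => c /=; rewrite ratr_int.
  rewrite !intrE dvdp_map dvdp_rat_int => /(Pdiv.IdomainMonic.dvdpP M_monic).
  case=> Q ->; rewrite hornerM; apply: dvdz_mull.
  rewrite horner_prod; under eq_bigr do rewrite cyclo1.
  by rewrite prodr_const natz.
have [z z_prim] := @C_prim_root_exists (N ^ m) (ltac:(by rewrite expn_gt0 N0)).
(* Up to a constant, [M] is a product of some of the distinct linear factors of ['X^(N ^ m) - 1], so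
   it suffices that each of its roots be a root of [P]. *)
rewrite -(factor_Xn_sub_1 z_prim) in Mdvd.
have [s Ms] := dvdp_prod_XsubC Mdvd.
rewrite (eqp_dvdl _ Ms) -(big_map (GRing.exp z) xpredT (fun y => 'X - y%:P)).
apply: uniq_roots_dvdp; last first.
  rewrite uniq_rootsE map_inj_in_uniq ?mask_uniq ?iota_uniq // => i j.
  move=> /mem_mask; rewrite mem_index_iota => /andP[_ ltim].
  move=> /mem_mask; rewrite mem_index_iota => /andP[_ ltjm] /eqP.
  by rewrite (eq_prim_root_expr z_prim) !modn_small // => /eqP.
apply/allP => y y_in.
have : root (map_poly intr M) y.
  rewrite (eqp_root Ms) -(big_map (GRing.exp z) xpredT (fun y => 'X - y%:P)).
  by rewrite root_prod_XsubC.
rewrite rmorph_prod /= rootE horner_prod prodf_seq_eq0.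
move=> /hasP[a _ /andP[aA ya]].
by have [] := root_cyclo N0 ya; apply: rootP.
Qed.

(** * Digit sums at roots of unity *)

Lemma expz_prim_root_eq1 (n : nat) (x : algC) (w : int) :
  n.-primitive_root x -> (x ^ w == 1) = (n%:Z %| w)%Z.
Proof.
move=> x_prim; rewrite dvdzE (prim_order_dvd x_prim).
by case: w => m //=; rewrite NegzE -invr_expz invr_eq1.
Qed.

Lemma prim_root_pow (N a : nat) (x : algC) : prime N ->
  x ^+ (N ^ a) != 1 -> x ^+ (N ^ a.+1) = 1 -> (N ^ a.+1).-primitive_root x.
Proof.
move=> Np xa xa1.
have [|n x_prim] := @prim_order_exists _ (N ^ a.+1) x _ xa1.
  by rewrite expn_gt0 prime_gt0.
case/(dvdn_pfactor _ _ Np) => e; rewrite leq_eqVlt => /orP[/eqP -> <-//|ea nE].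
case/negP: xa; rewrite -(prim_order_dvd x_prim) nE dvdn_exp2l //.
Qed.

(** The mask polynomial at [x] factors since the digits vary independently. Weights may be negative,
    hence the integer exponents and [x != 0]. *)
Lemma sum_expz_digit_sum (N : nat) (I : finType) (W : I -> int) (x : algC) :
    x != 0 ->
  \sum_(u : {ffun I -> 'I_N}) x ^ digit_sum W u =
  \prod_i \sum_(j < N) (x ^ W i) ^+ j.
Proof.
move=> x0; rewrite bigA_distr_bigA /=; apply: eq_bigr => u _.
have E : {morph (fun m : int => x ^ m) : m n / m + n >-> m * n}.
  by move=> m n; exact: expfzDr.
rewrite /digit_sum (big_morph _ E (expr0z x)); apply: eq_bigr => i _.
by rewrite exprnP exprz_exp mulrC.
Qed.

(** If the factor of [i] vanished, [x ^ W i] would be an [N]-th root of unity other than 1. Then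
    [N ^ a.+1] would divide [N * W i] but not [W i], forcing the valuation [a]. *)
Lemma expz_digit_sum_neq0 (N a : nat) (I : finType) (W : I -> int)
    (x : algC) :
    prime N -> (forall i, W i != 0) -> (N ^ a.+1).-primitive_root x ->
    (forall i, tau N (W i) != a) ->
  \sum_(u : {ffun I -> 'I_N}) x ^ digit_sum W u != 0.
Proof.
move=> Np W0 x_prim ta.
have x0 : x != 0 by rewrite (prim_root_eq0 x_prim) -lt0n expn_gt0 prime_gt0.
rewrite sum_expz_digit_sum //.
apply/prodf_neq0 => i _.
have N0 : (N%:R : algC) != 0 by rewrite pnatr_eq0 -lt0n prime_gt0.
have x1 : (x ^ W i == 1) = (a < tau N (W i))%N.
  by rewrite (expz_prim_root_eq1 _ x_prim) PoszX dvdz_exp_tau ?prime_gt1.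
apply/eqP => sum0; have : x ^ W i != 1.
  apply: contraNneq N0 => w1; move: sum0; rewrite w1.
  by under eq_bigr do rewrite expr1n; rewrite sumr_const card_ord => ->.
rewrite x1 -leqNgt leq_eqVlt (negbTE (ta i)) /= => lt_ta.
have : (x ^ W i) ^+ N = 1.
  by apply/eqP; rewrite -subr_eq0 subrX1 sum0 mulr0.
rewrite exprnP exprz_exp => /eqP.
rewrite (expz_prim_root_eq1 _ x_prim) PoszX exprSr dvdz_mul2r.
  by rewrite dvdz_exp_tau ?prime_gt1 // leqNgt lt_ta.
by rewrite eqz_nat -lt0n prime_gt0.
Qed.

(** * From tilings to distinct valuations *)

(* This is the condition (T1) of Coven and Meyerowitz. *)
Lemma inj_tau_of_bij (N p : nat) (I : finType) (W : I -> int)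
    (L : {set 'I_p}) (f : {ffun I -> 'I_N} * {r : 'I_p | r \in L} -> 'I_p) :
    prime N -> (0 < p)%N -> (forall i, W i != 0) -> bijective f ->
    (forall u, (f u = digit_sum W u.1 + val (val u.2) %[mod p])%Z) ->
  injective (fun i => tau N (W i)).
Proof.
move=> Np p0 W0 f_bij fE.
have cardp : (N ^ #|I| * #|L| = p)%N.
  have := bij_eq_card f_bij.
  by rewrite card_prod card_ffun card_sig !card_ord.
set m := logn N p.
have Npm : (N ^ m %| p)%N by rewrite pfactor_dvdnn.
pose A := [set a : 'I_m | [forall i, tau N (W i) != a]]%SET.
pose P : {poly int} := \sum_(r in L) 'X^r.
have P1 : P.[1] = #|L|%:Z.
  rewrite horner_sum; under eq_bigr do rewrite hornerXn expr1n.
  by rewrite sumr_const natz.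
have dvdL : (N ^ #|A| %| #|L|)%N.
  have := @dvdz_horner1 N m A P (prime_gt0 Np).
  rewrite P1 dvdzE abszX !absz_nat; apply.
  move=> a x; rewrite inE => /forallP ta xa xa1.
  have x_prim := prim_root_pow Np xa xa1.
  have x0 : x != 0 by rewrite (prim_root_eq0 x_prim) -lt0n expn_gt0 prime_gt0.
  have xp : x ^+ p = 1.
    apply/eqP; rewrite -(prim_order_dvd x_prim).
    exact: dvdn_trans (dvdn_exp2l _ (ltn_ord a)) Npm.
  have x_mod (c d : int) : (c = d %[mod p])%Z -> x ^ c = x ^ d.
    move=> cd; rewrite (divz_eq c p) (divz_eq d p) cd !expfzDr //.
    by rewrite ![(_ %/ _)%Z * _]mulrC -!exprz_exp -exprnP xp !exp1rz.
  have x1 : x != 1 by apply: contraNneq xa => ->; rewrite expr1n.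
  have sum0 : \sum_(z < p) x ^ z = 0.
    have := subrX1 x p; rewrite xp subrr => /esym/eqP.
    by rewrite mulf_eq0 subr_eq0 (negbTE x1) => /eqP.
  (* Reindexing by [f] turns the vanishing sum over all residues into the factor of the digit sums
     times the factor of [L]. The first is nonzero because [a] is not a valuation. *)
  move: sum0; rewrite (reindex f) /=; last exact: onW_bij.
  rewrite (eq_bigr
    (fun u => x ^ digit_sum W u.1 * x ^+ val (val u.2))); last first.
    by move=> u _; rewrite (x_mod _ _ (fE u)) expfzDr.
  rewrite -(pair_bigA _ (fun u r => x ^ digit_sum W u * x ^+ val (val r))) /=.
  under eq_bigr do rewrite -mulr_sumr.
  rewrite -mulr_suml => /eqP; rewrite mulf_eq0.
  rewrite (negbTE (expz_digit_sum_neq0 Np W0 x_prim ta)) /= => /eqP sumL.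
  apply/rootP; rewrite rmorph_sum horner_sum -[RHS]sumL.
  rewrite (reindex_omap (op := +%R) (val : {r | r \in L} -> 'I_p) insub) /=;
    last first.
    by move=> r rL; rewrite insubT.
  apply: eq_big => [r|r _]; last by rewrite map_polyXn hornerXn.
  by rewrite (valP r) valK eqxx.
(* Both [N ^ #|I|] and the divisor [N ^ #|A|] of [#|L|] are factors in the product [p], whose
   [N]-adic valuation is [m]. *)
have leI : (#|I| + #|A| <= m)%N.
  rewrite -pfactor_dvdn // -cardp expnD dvdn_mul //.
(* Valuations that are [m] or more are sent to [None]. *)
pose h (i : I) : option 'I_m := insub (tau N (W i)).
have leIA : (#|I| <= #|~: A|)%N.
  by rewrite -(leq_add2r #|A|) [X in (_ <= X)%N]addnC cardsC card_ord.
move=> i j ij; apply/eqP/negPn/negP => nij.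
suff : (#|~: A| < #|I|)%N by rewrite ltnNge leIA.
(* The complement of [A] consists of the valuations below [m]. If [i] and [j] share one, the indices
   other than [i] already produce all of them, too few for [leIA]. *)
have sub : ((@Some 'I_m) @: (~: A) \subset h @: [set~ i])%SET.
  apply/fintype.subsetP => _ /imsetP[a aA ->]; move: aA.
  rewrite !inE negb_forall => /existsP[l]; rewrite negbK => /eqP la.
  have [li|nli] := eqVneq l i.
    by apply/imsetP; exists j; rewrite ?inE 1?eq_sym // /h -ij -li la valK.
  by apply/imsetP; exists l; rewrite ?inE // /h la valK.
have := subset_leq_card sub; rewrite card_imset => [leS|? ? [] //].
apply: leq_ltn_trans leS _.
apply: leq_ltn_trans (leq_imset_card _ _) _.
by rewrite cardsC1 ltn_predL; apply/card_gt0P; exists i.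
Qed.

(** Replacing [L] by its set [R] of residues modulo [p] gives a finite counting problem. Uniqueness
    in the tiling and directness make [f] injective; existence makes it surjective. *)
Lemma inj_tau_of_tile (N k : nat) (w : 'I_k -> int) :
    prime N -> (forall i, w i != 0) ->
    direct (fun i => digits N (w i)) ->
    integer_tile (sumset (fun i => digits N (w i))) ->
  injective (fun i => tau N (w i)).
Proof.
move=> Np w0 /(direct_digitsP N w0) w_inj [_ [p [L [p0 tile]]]].
pose res (m : int) : 'I_p := Ordinal (ltn_absz_modz m p0).
have resE (m : int) : ((res m : nat)%:Z = m %[mod p])%Z.
  by rewrite /= absz_modz // modz_mod.
have uniq_tile (x y : {ffun 'I_k -> 'I_N}) l l' : L l -> L l' ->
    (digit_sum w x + l = digit_sum w y + l' %[mod p])%Z -> x = y /\ l = l'.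
  move=> Ll Ll' xy; have [dl [_ dlU]] := tile (digit_sum w y + l').
  have sumP (u : {ffun 'I_k -> 'I_N}) :
      sumset (fun i => digits N (w i)) (digit_sum w u).
    by apply/sumset_digitsP; exists u.
  have := dlU (digit_sum w x, l) (And3 (sumP x) Ll xy).
  rewrite (dlU (digit_sum w y, l') (And3 (sumP y) Ll' erefl)).
  by case=> /w_inj -> ->.
pose R := [set r : 'I_p | `[< exists2 l, L l & res l = r >]]%SET.
have RP (r : {r : 'I_p | r \in R}) : exists2 l, L l & res l = val r.
  by have := valP r; rewrite inE => /asboolP.
pose f (u : {ffun 'I_k -> 'I_N} * {r : 'I_p | r \in R}) : 'I_p :=
  res (digit_sum w u.1 + val (val u.2)).
have modD (a c d : int) : (c = d %[mod p])%Z -> (a + c = a + d %[mod p])%Z.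
  by move=> cd; rewrite -modzDmr cd modzDmr.
have f_inj : injective f.
  move=> [x r] [y r'] /(congr1 (fun i : 'I_p => (i : nat)%:Z)).
  rewrite /f /= !absz_modz //.
  have [l Ll lr] := RP r; have [l' Ll' lr'] := RP r'.
  rewrite -lr -lr' (modD _ _ _ (resE l)) (modD _ _ _ (resE l')) => xy.
  have [-> ll'] := uniq_tile _ _ _ _ Ll Ll' xy.
  by congr (_, _); apply: val_inj; rewrite -lr -lr' ll'.
have f_surj z : exists u, f u = z.
  have [[d l] [[/= /sumset_digitsP[x ->] Ll dlz] _]] := tile (val z)%:Z.
  have lR : res l \in R by rewrite inE; apply/asboolP; exists l.
  exists (x, Sub (res l) lR); rewrite /f /=.
  apply: val_inj => /=; apply/eqP; rewrite -eqz_nat absz_modz //.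
  rewrite (modD _ _ _ (resE l)) dlz modz_small // lez_nat /= ltz_nat.
  exact: ltn_ord.
have /choice[g gK] := f_surj.
apply: (@inj_tau_of_bij N p _ w R f) => // [|u]; last first.
  exact: resE.
by exists g => // u; apply: f_inj; rewrite gK.
Qed.

(** * The weights of the theorem *)

Definition weight (b t : nat -> int) (k : nat) (i : 'I_k) : int :=
  (\prod_((k - i).+1 <= l < k.+1) b l) * t (k - i)%N.

Lemma summandE (N : nat) (b t : nat -> int) (k : nat) :
  @summand N b t k = fun i => digits N (weight b t i).
Proof.
apply/funext => i; apply/seteqP; split=> [_ [_ [j jN <-] <-]|_ [j jN <-]].
  by exists j => //; rewrite mulrCA.
by exists (j%:Z * t (k - i)%N); [exists j | rewrite mulrCA].
Qed.

Lemma prod_nat_neq0 (b : nat -> int) (m n : nat) :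
    (forall k, (0 < k)%N -> b k != 0) -> (0 < m)%N ->
  \prod_(m <= l < n) b l != 0.
Proof.
move=> b0 m0; rewrite prodf_seq_neq0; apply/allP => l.
by rewrite mem_index_iota => /andP[ml _]; exact: b0 (leq_trans m0 ml).
Qed.

Lemma weight_neq0 (b t : nat -> int) (k : nat) (i : 'I_k) :
    (forall k, (0 < k)%N -> b k != 0) -> (forall k, (0 < k)%N -> t k != 0) ->
  weight b t i != 0.
Proof. by move=> b0 t0; rewrite mulf_neq0 ?prod_nat_neq0 ?t0 ?subn_gt0. Qed.

(** The product of all the [b l] splits at [k - i] into the part occurring in [s_] and the part
    occurring in the weight, while the valuation of [t] cancels. The 1 comes from the factor [N] in
    [N * t]. For fixed [k], two weights thus have equal valuations exactly when their values of [s_]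
    agree. *)
Lemma tau_weight (N : nat) (b t : nat -> int) (k : nat) (i : 'I_k) :
    prime N ->
    (forall k, (0 < k)%N -> b k != 0) -> (forall k, (0 < k)%N -> t k != 0) ->
  (tau N (weight b t i))%:Z + s_ N b t (k - i) =
  (tau N (\prod_(1 <= l < k.+1) b l))%:Z - 1.
Proof.
move=> N_prime b0 t0; have ki0 : (0 < k - i)%N by rewrite subn_gt0.
have NE : tau N N%:Z = 1%N.
  rewrite tauE ?eqz_nat -?lt0n ?prime_gt0 // absz_nat.
  by rewrite -[X in logn _ X]expn1 pfactorK.
rewrite (big_cat_nat (n := (k - i).+1)) //=; last by rewrite ltnS leq_subr.
rewrite /s_ /weight !tauM ?prod_nat_neq0 ?t0 // ?NE; last first.
  by rewrite eqz_nat -lt0n prime_gt0.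
by rewrite !PoszD; ring.
Qed.

Theorem theorem1p2 (N : nat) (b t : nat -> int)
  (N_prime : prime N)
  (b_ge2 : forall k : nat, (0 < k)%N -> 2 <= `|b k|)
  (t_bounded : exists M : int, forall k : nat, (0 < k)%N -> `|t k| <= M)
  (t_ge1 : forall k : nat, (0 < k)%N -> 1 <= `|t k|) :
  (forall k : nat, (0 < k)%N ->
     direct (@summand N b t k) /\ integer_tile (sumset (@summand N b t k)))
  <->
  (forall i j : nat, (0 < i)%N -> (0 < j)%N -> i <> j ->
     s_ N b t i <> s_ N b t j).
Proof.
have b0 k : (0 < k)%N -> b k != 0.
  by move=> /b_ge2; rewrite -normr_gt0; apply: lt_le_trans.
have t0 k : (0 < k)%N -> t k != 0.
  by move=> /t_ge1; rewrite -normr_gt0; apply: lt_le_trans.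
split=> [tiles|s_inj k k0].
  have lt_neq i j : (0 < i)%N -> (i < j)%N -> s_ N b t i <> s_ N b t j.
    move=> i0 ij s_eq; have j0 := ltn_trans i0 ij.
    have [] := tiles j j0; rewrite summandE => dir tile.
    have w_inj :=
      inj_tau_of_tile N_prime (fun i => weight_neq0 i b0 t0) dir tile.
    (* In the [j]-th sumset, the weight of index [i] stands at position [j - i] and that of index
       [j] at position 0. *)
    have ltj : (j - i < j)%N by rewrite ltn_subrL i0.
    have /w_inj/(congr1 val)/eqP /= : tau N (weight b t (Ordinal ltj)) =
        tau N (weight b t (Ordinal j0)).
      apply/eqP; rewrite -eqz_nat; apply/eqP/(addIr (s_ N b t i)).
      have := tau_weight (Ordinal ltj) N_prime b0 t0.
      rewrite /= (subKn (ltnW ij)) => ->; rewrite s_eq.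
      by have := tau_weight (Ordinal j0) N_prime b0 t0; rewrite /= subn0.
    by rewrite subn_eq0 leqNgt ij.
  move=> i j i0 j0 /eqP; rewrite neq_ltn => /orP[ij|ji]; first exact: lt_neq.
  by move=> /esym; apply: lt_neq.
rewrite summandE; apply: tile_of_inj_tau => // [|i j ij].
  by move=> i; exact: weight_neq0 i b0 t0.
have : s_ N b t (k - i) = s_ N b t (k - j).
  apply: (addrI (tau N (weight b t i))%:Z).
  by rewrite tau_weight // ij tau_weight.
apply: contra_eq => nij; apply/eqP/s_inj; rewrite ?subn_gt0 //.
move=> kij; case/eqP: nij; apply: val_inj => /=.
by rewrite -(subKn (ltnW (ltn_ord i))) kij subKn // ltnW.
Qed.
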